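(* Fix a cardinal $\kappa<\mathfrak s$. If $\lambda$ is a cardinal with $\lambda<\mathfrak s$, then the family of all sequentially compact Hausdorff spaces $X$ with $\mathrm{cHw}(X)\le\kappa$ is $\lambda$-ssc.
   Context: $[\omega]^\omega$ is the set of all infinite subsets of $\omega$. A sequence $x=\langle x_n:n<\omega\rangle$ converges along $H\in[\omega]^\omega$ if the subsequence $\langle x_n:n\in H\rangle$ converges. A family (possibly a proper class) $\mathcal F$ of topological spaces is $\lambda$-ssc if for any $\lambda$-many sequences, each with values in one of the spaces in $\mathcal F$ (possibly different spaces for different sequences), there is $H\in[\omega]^\omega$ such that each of these sequences converges along $H$. A family $\mathcal S\subseteq[\omega]^\omega$ is splitting if for every $A\in[\omega]^\omega$ there is $S\in\mathcal S$ with $A\cap S$ and $A\setminus S$ both infinite; $\mathfrak s$ is the least cardinality of a splitting family. For a space $X$ and $Y\subseteq X$, $\mathcal L(Y)$ is the set of all $p\in X$ such that some sequence in $Y$ converges to $p$, and $\mathrm{SeqCl}(Y)$ is the smallest sequentially closed subset of $X$ containing $Y$. A sequentially separating limit cover for $Y$ is a family $\mathcal C_Y$ of open subsets of $\mathcal L(Y)$ (with the subspace topology) such that for each $p\in\mathcal L(Y)$ and each $q\in X$ with $q\ne p$ there is $U\in\mathcal C_Y$ with $p\in U$ and $q\notin\mathrm{SeqCl}(U)$. For a Hausdorff space $X$, the countable Hausdorff weight $\mathrm{cHw}(X)$ is the least infinite cardinal $\theta$ such that each countable $Y\subseteq X$ admits a sequentially separating limit cover $\mathcal C_Y$ with $|\mathcal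 C_Y|\le\theta$. *)

(* Defs.v *)
From mathcomp Require Import all_boot all_order all_classical.
From mathcomp Require Import topology.

Set Implicit Arguments.
Unset Strict Implicit.
Unset Printing Implicit Defensive.

Local Open Scope classical_set_scope.
Local Open Scope card_scope.

(** Cardinals are represented by types (or sets) up to equipotence, and compared
    with [#<=]. *)

Definition card_lt T U (A : set T) (B : set U) : Prop := A #<= B /\ ~ (B #<= A).
Notation "A '#<' B" := (card_lt A B) (at level 79) : card_scope.

(* Cardinals are well-ordered: a maximal set of choice functions that pairwise
   differ at every index surjects onto some [T i]. *)
Lemma least_card (I : Type) (T : I -> Type) (i0 : I) :
  exists i, forall j, [set: T i] #<= [set: T j].
Proof.
pose dis (F : set (forall i, T i)) :=
  forall f g, F f -> F g -> forall i, f i = g i -> f = g.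
have [|F [Fdis Fmax]] := @Zorn_bigcup _ dis.
  move=> C Cdis Ctot f g [A CA Af] [B CB Bg] i fg.
  have [AB|BA] := Ctot _ _ CA CB.
    exact: (Cdis _ CB f g (AB _ Af) Bg i).
  exact: (Cdis _ CA f g Af (BA _ Bg) i).
have [i Fi] : exists i, forall x : T i, exists2 f, F f & f i = x.
  apply: contrapT => /forallNP noF.
  have miss i : {x : T i | forall f, F f -> f i <> x}.
    apply: cid; apply: contrapT => /forallNP h; apply: (noF i) => x.
    apply: contrapT => h'; apply: (h x) => f Ff fx; apply: h'; by exists f.
  pose g i := sval (miss i).
  have gF f : F f -> forall i, f i <> g i by move=> Ff i; exact: (svalP (miss i)).
  apply: (Fmax (F `|` [set g])).
    split=> [f Ff|sub]; first by left.
    by apply: (gF g _ i0) => //; apply: sub; right.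
  move=> a b [Fa|->] [Fb|->] i //.
  - exact: Fdis.
  - by move/(gF _ Fa).
  - by move/esym/(gF _ Fb).
exists i => j.
have h (x : T i) : {f | F f /\ f i = x}.
  by apply: cid; have [f ? ?] := Fi x; exists f.
suff : $|{injfun [set: T i] >-> [set: T j]}| by move=> [f]; exact: inj_card_le.
apply/injfunPex; exists (fun x => sval (h x) j) => // x y _ _ exy.
have [[Fx hx] [Fy hy]] := (svalP (h x), svalP (h y)).
by rewrite -hx -hy (Fdis _ _ Fx Fy _ exy).
Qed.

Lemma card_le_total (T U : Type) : [set: T] #<= [set: U] \/ [set: U] #<= [set: T].
Proof.
have [[] h] := @least_card bool (fun b => if b then T else U) true.
  by left; exact: (h false).
by right; exact: (h true).
Qed.

Definition splitting (S : set (set nat)) : Prop :=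
  (forall A, S A -> infinite_set A) /\
  (forall A, infinite_set A ->
    exists2 B, S B & infinite_set (A `&` B) /\ infinite_set (A `\` B)).

Lemma infinite_range_nat T (f : nat -> T) : injective f -> infinite_set (range f).
Proof.
move=> fI; apply/infiniteP; suff : $|{injfun [set: nat] >-> range f}|.
  by move=> [g]; exact: inj_card_le.
by apply/injfunPex; exists f => [n _|m n _ _ /fI//]; exists n.
Qed.

Lemma splitting_infinite_sets : splitting [set A | infinite_set A].
Proof.
split=> // A /infiniteP /pcard_leP [e].
have eI : injective e by move=> m n; apply: 'inj_e; rewrite inE.
have eA n : A (e n) by exact: 'funS_e.
have I2 : injective (fun n => e n.*2) by move=> m n /eI/double_inj.
exists (range (fun n => e n.*2)); first exact: infinite_range_nat.
split.
  by apply: sub_infinite_set (infinite_range_nat I2) => _ [n _ <-]; split=> //; exists n.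
have I3 : injective (fun n => e n.*2.+1) by move=> m n /eI [] /double_inj.
apply: sub_infinite_set (infinite_range_nat I3) => _ [n _ <-].
by split=> // -[m _ /eI /(congr1 odd)] /=; rewrite !odd_double.
Qed.

Lemma splitting_number_ex :
  exists S, splitting S /\ forall S', splitting S' -> S #<= S'.
Proof.
have [[S SS] Smin] := @least_card {S | splitting S} (fun S => set_type (sval S))
  (exist _ _ splitting_infinite_sets).
exists S; split=> // S' SS'; have := Smin (exist _ _ SS').
by rewrite /= (card_le_eql (card_setT _)) (card_le_eqr (card_setT _)).
Qed.

(* A splitting family of least cardinality; only its cardinality matters. *)
Definition splitting_number : set (set nat) := sval (cid splitting_number_ex).

Lemma splitting_numberP : splitting splitting_number /\
  forall S, splitting S -> splitting_number #<= S.
Proof. exact: (svalP (cid splitting_number_ex)). Qed.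

Section Sequences.
Variable X : topologicalType.

Definition converges_along (x : nat -> X) (H : set nat) : Prop :=
  exists l : X, x n @[n --> within H \oo] --> l.

Definition sequentially_compact : Prop :=
  forall x : nat -> X, exists2 H, infinite_set H & converges_along x H.

Definition seq_limits (Y : set X) : set X :=
  [set p | exists2 u : nat -> X, (forall n, Y (u n)) & u n @[n --> \oo] --> p].

Definition sequentially_closed (Z : set X) : Prop := seq_limits Z `<=` Z.

Definition SeqCl (Y : set X) : set X := smallest sequentially_closed Y.

Definition seq_sep_limit_cover (Y : set X) (C : set (set X)) : Prop :=
  (forall U, C U -> exists2 V, open V & U = seq_limits Y `&` V) /\
  (forall p q, seq_limits Y p -> q <> p ->
    exists2 U, C U & U p /\ ~ SeqCl U q).

Definition cHw_bound (theta : Type) : Prop :=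
  infinite_set [set: theta] /\
  forall Y : set X, countable Y ->
    exists2 C, seq_sep_limit_cover Y C & C #<= [set: theta].

Hypothesis hX : hausdorff_space X.

Lemma cHw_bound_sets : cHw_bound (set X + nat).
Proof.
split.
  apply: sub_infinite_set (@infinite_range_nat _ (@inr (set X) nat) _) => //.
  by move=> m n [].
move=> Y _; exists [set U | exists2 V, open V & U = seq_limits Y `&` V].
  split=> // p q Yp /eqP; rewrite eq_sym => pq.
  have [[A B] [/set_mem Ap /set_mem Bq] [oA oB /eqP AB]] :
      exists2 AB : set X * set X, (p \in AB.1 /\ q \in AB.2) &
        [/\ open AB.1, open AB.2 & AB.1 `&` AB.2 == set0].
    by move: hX; rewrite open_hausdorff; apply.
  exists (seq_limits Y `&` A); first by exists A.
  split=> // qA; have : (~` B) q; last exact.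
  apply: (qA (~` B)); split=> [z [u uB uz] Bz|z [_ Az] Bz]; last first.
    by have : (A `&` B) z by []; rewrite AB.
  have [n _ nB] : \forall n \near \oo, B (u n).
    by apply: uz; exact: open_nbhs_nbhs.
  exact: (uB n) (nB n (leqnn n)).
suff : $|{injfun [set U : set X | exists2 V, open V & U = seq_limits Y `&` V]
    >-> [set: set X + nat]}| by move=> [f]; exact: inj_card_le.
by apply/injfunPex; exists inl => // U V _ _ [].
Qed.

Lemma cHw_bound_le (T U : Type) :
  [set: T] #<= [set: U] -> cHw_bound T -> cHw_bound U.
Proof.
move=> TU [Tinf TC]; split.
  by move: Tinf; rewrite !infiniteP => /card_le_trans; apply.
move=> Y /TC[C CY CT]; exists C => //; exact: card_le_trans CT TU.
Qed.

Lemma cHw_ex : exists A : set (set X + nat), cHw_bound A /\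
  forall theta : Type, cHw_bound theta -> A #<= [set: theta].
Proof.
pose W := (set X + nat)%type.
have WT : cHw_bound [set: W].
  by apply: cHw_bound_le cHw_bound_sets; rewrite (card_le_eqr (card_setT _)).
have [[A HA] Amin] := @least_card {A : set W | cHw_bound A}
  (fun A => set_type (sval A)) (exist (fun A : set W => cHw_bound A) _ WT).
exists A; split=> // T HT.
have [TW|WleT] := card_le_total T W; last first.
  by apply: card_le_trans WleT; apply: subset_card_le.
have [B TB] : exists B : set W, [set: T] #= B.
  have /card_leP[f] := TW; pose g x := val (f (SigSub (in_setT x))).
  exists (range g); rewrite card_eq_sym; apply/inj_card_eq => x y _ _ /val_inj gxy.
  by have [] : SigSub (in_setT x) = SigSub (in_setT y)
    by apply: (@inj _ _ setT f) => //; rewrite inE.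
have HB : cHw_bound B.
  by apply: cHw_bound_le HT; rewrite (card_le_eqr (card_setT _)) -(card_le_eqr TB).
have := Amin (exist (fun A : set W => cHw_bound A) _ HB).
rewrite /= (card_le_eql (card_setT _)) (card_le_eqr (card_setT _)).
by rewrite (card_le_eqr TB).
Qed.

(* A set of cardinality cHw(X). *)
Definition cHw : set (set X + nat) := sval (cid cHw_ex).

Lemma cHwP : cHw_bound cHw /\
  forall theta : Type, cHw_bound theta -> cHw #<= [set: theta].
Proof. exact: (svalP (cid cHw_ex)). Qed.

End Sequences.

(* [F] is lambda-ssc, where lambda is the cardinality of [L]. *)
Definition ssc (L : Type) (F : topologicalType -> Prop) : Prop :=
  forall (X : L -> topologicalType) (x : forall i, nat -> X i),
    (forall i, F (X i)) ->
    exists2 H, infinite_set H & forall i, converges_along (x i) H.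

(* Main.v *)
Require Import Defs.
From mathcomp Require Import all_boot all_order all_classical.
From mathcomp Require Import topology.

(** Let [x] be a sequence in a sequentially compact space with a sequentially
    separating limit cover [C] of its range. Convergence of [x] along an
    infinite [H] follows as soon as no trace [x @^-1` U], [U] in [C], splits
    [H] ([unsplit_converges]): if [x] has two subsequences inside [H], with
    distinct limits [p] and [q], take [U] in [C] with [p] in [U] and [q] outside
    [SeqCl U]. As [U] is open in the limit set of the range, which contains the
    range itself, the first subsequence is eventually in [U]; so almost all
    terms along [H] are in [U], and the second subsequence puts [q] in
    [SeqCl U].

    There are lambda sequences and at most kappa traces for each, hence at most
    lambda * kappa traces, and it remains to see that this cardinal is still
    below the splitting number: then the traces do not form a splitting family
    and a common [H] exists ([unsplit_ex]). When kappa is infinite, the product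
    is the larger factor, by the theorem of Hessenberg that an infinite type is
    equipotent to its square ([infinite_card_square], [card_lt_prod]). A bound
    on the countable Hausdorff weight is infinite by definition, so this applies
    as soon as there is at least one sequence. *)

Local Open Scope classical_set_scope.
Local Open Scope card_scope.

Set Implicit Arguments.
Unset Strict Implicit.

(** * Infinite cardinals are idempotent *)

Lemma card_le_fun T U (A : set T) (B : set U) (b : U) :
  B b -> A #<= B ->
  exists f : T -> U, (forall x, A x -> B (f x)) /\
    (forall x y, A x -> A y -> f x = f y -> x = y).
Proof.
elim/Ppointed: U => U in B b *; first by case: (no b).
move=> _ /pcard_leP[f]; exists f; split=> [x Ax|x y Ax Ay].
  exact: 'funS_f.
by move/('inj_f); apply; rewrite inE.
Qed.

Lemma fun_card_le T U (A : set T) (B : set U) (f : T -> U) :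
  (forall x, A x -> B (f x)) ->
  (forall x y, A x -> A y -> f x = f y -> x = y) -> A #<= B.
Proof.
move=> fAB finj.
suff : $|{injfun A >-> B}| by move=> [g]; exact: inj_card_le.
apply/injfunPex; exists f => // x y /set_mem Ax /set_mem Ay; exact: finj.
Qed.

(** The approximations for which Zorn's lemma is used in
    [infinite_card_square]. Pairings are only required to be injective, and are
    total on [T] with junk values outside [D], which avoids partial functions.
    The two distinct elements give an injection of [D + D] into [D * D]. *)
Definition self_pairing T (D : set T) (g : T -> T -> T) : Prop :=
  [/\ exists c d, [/\ D c, D d & c <> d],
      forall a b, D a -> D b -> D (g a b) &
      forall a b a' b', D a -> D b -> D a' -> D b' ->
        g a b = g a' b' -> a = a' /\ b = b'].

(** This is [D + E <= D + D <= D * D <= D]; the two distinct elements [c] and [d]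
    of [D] serve as tags for the summands. *)
Lemma self_pairing_absorb T (D E : set T) g :
  self_pairing D g -> E #<= D ->
  exists phi : T -> T, (forall x, (D `|` E) x -> D (phi x)) /\
    (forall x y, (D `|` E) x -> (D `|` E) y -> phi x = phi y -> x = y).
Proof.
move=> [[c [d [Dc Dd cd]]] gD ginj] /(card_le_fun Dc)[j [jD jinj]].
exists (fun x => if pselect (D x) then g c x else g d (j x)); split.
  move=> x xDE; case: pselect => Dx; first exact: gD.
  by case: xDE => // /jD; exact: gD.
move=> x y xDE yDE; case: pselect => Dx; case: pselect => Dy.
- by move=> /(ginj _ _ _ _ Dc Dx Dc Dy)[].
- by case: yDE => // /jD Djy /(ginj _ _ _ _ Dc Dx Dd Djy)[].
- by case: xDE => // /jD Djx /(ginj _ _ _ _ Dd Djx Dc Dy)[/esym].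
- case: xDE => // Ex; case: yDE => // Ey.
  by move=> /(ginj _ _ _ _ Dd (jD _ Ex) Dd (jD _ Ey))[_]; exact: jinj.
Qed.

(** A disjoint copy [e @` D] of [D] is room enough to extend the pairing:
    [(D + D) * (D + D)] injects into [D * D], hence into [D], so all the pairs
    that are not yet coded can get their codes in the copy. *)
Lemma self_pairing_double T (D : set T) g e :
  self_pairing D g -> (forall x, D x -> ~ D (e x)) ->
  (forall x y, D x -> D y -> e x = e y -> x = y) ->
  exists g', self_pairing (D `|` e @` D) g' /\
    forall a b, D a -> D b -> g' a b = g a b.
Proof.
move=> Dg eD einj.
have [phi [phiD phiI]] := self_pairing_absorb Dg (card_image_le e D).
have [[c [d [Dc Dd cd]]] gD ginj] := Dg.
pose D' := D `|` e @` D.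
exists (fun a b => if pselect (D a /\ D b) then g a b else e (g (phi a) (phi b))).
split; last by move=> a b Da Db; case: pselect => // -[].
split; first by exists c, d; split=> //; left.
  move=> a b D'a D'b /=; case: pselect => [[Da Db]|? /=]; first by left; exact: gD.
  by right; exists (g (phi a) (phi b)) => //; apply: gD; exact: phiD.
move=> a b a' b' Da Db Da' Db' /=.
have De x y : D' x -> D' y -> D (g (phi x) (phi y)).
  by move=> ? ?; apply: gD; exact: phiD.
case: pselect => [[Ea Eb]|nab]; case: pselect => [[Ea' Eb']|nab'] /=.
- exact: ginj.
- by move=> eg; case: (eD _ (De _ _ Da' Db')); rewrite -eg; exact: gD.
- by move=> eg; case: (eD _ (De _ _ Da Db)); rewrite eg; exact: gD.
- move/(einj _ _ (De _ _ Da Db) (De _ _ Da' Db')).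
  case/(ginj _ _ _ _ (phiD _ Da) (phiD _ Db) (phiD _ Da') (phiD _ Db')).
  by move=> /(phiI _ _ Da Da') -> /(phiI _ _ Db Db') ->.
Qed.

(** In a chain of pairings extending each other, finitely many elements of the
    union all belong to one member, and the members agree on them. *)
Lemma self_pairing_bigcup T (C : set (set T * (T -> T -> T))) s0 :
  C s0 -> (forall s, C s -> self_pairing s.1 s.2) ->
  (forall s t, C s -> C t ->
    (s.1 `<=` t.1 /\ forall a b, s.1 a -> s.1 b -> t.2 a b = s.2 a b) \/
    (t.1 `<=` s.1 /\ forall a b, t.1 a -> t.1 b -> s.2 a b = t.2 a b)) ->
  exists g, self_pairing (\bigcup_(s in C) s.1) g /\
    forall s a b, C s -> s.1 a -> s.1 b -> g a b = s.2 a b.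
Proof.
move=> Cs0 Csp Ctot; set D := \bigcup_(s in C) s.1.
have join s t : C s -> C t -> exists2 u, C u & s.1 `<=` u.1 /\ t.1 `<=` u.1.
  by move=> Cs Ct; case: (Ctot _ _ Cs Ct) => -[st _];
    [exists t => //; split|exists s => //; split].
have /choice[g gP] : forall ab : T * T, exists z,
    forall s, C s -> s.1 ab.1 -> s.1 ab.2 -> z = s.2 ab.1 ab.2.
  move=> [a b]; case: (pselect (exists s, [/\ C s, s.1 a & s.1 b])) => [|nex].
    move=> [s [Cs sa sb]]; exists (s.2 a b) => t Ct /= ta tb.
    by case: (Ctot _ _ Cs Ct) => -[_ h]; rewrite h.
  by exists a => s Cs sa sb; case: nex; exists s.
have gE s a b : C s -> s.1 a -> s.1 b -> g (a, b) = s.2 a b.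
  by move=> Cs sa sb; exact: gP.
exists (fun a b => g (a, b)); split=> //; split.
- have [[c [d [Dc Dd cd]]] _ _] := Csp _ Cs0.
  by exists c, d; split=> //; exists s0.
- move=> a b [s Cs sa] [t Ct tb]; have [u Cu [su tu]] := join _ _ Cs Ct.
  have [_ uD _] := Csp _ Cu.
  by exists u => //; rewrite (gE u) //; [apply: uD|..]; auto.
- move=> a b a' b' [s Cs sa] [t Ct tb] [s' Cs' sa'] [t' Ct' tb'].
  have [u Cu [su tu]] := join _ _ Cs Ct.
  have [u' Cu' [su' tu']] := join _ _ Cs' Ct'.
  have [w Cw [uw uw']] := join _ _ Cu Cu'.
  have [_ _ wI] := Csp _ Cw.
  rewrite !(gE w) //; auto => /wI; apply; auto.
Qed.

Lemma infinite_self_pairing T : infinite_set [set: T] ->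
  exists s : set T * (T -> T -> T), self_pairing s.1 s.2.
Proof.
move=> /[dup] /infinite_setN0[t0 _] /infiniteP.
move=> /(@card_le_fun _ _ _ _ t0 I)[h [_ hI]].
have {}hI m n : h m = h n -> m = n by exact: hI.
have [hinv hK] : exists k, cancel h k.
  have /choice[k kP] : forall t, exists n, forall m, h m = t -> n = m.
    move=> t; case: (pselect (exists n, h n = t)) => [[n <-]|nt].
      by exists n => m /hI.
    by exists 0 => m hm; case: nt; exists m.
  by exists k => n; exact: kP.
exists (range h, fun a b => h (pickle (hinv a, hinv b))); split=> /=.
- by exists (h 0), (h 1); split; [exists 0|exists 1|move/hI].
- by move=> a b _ _; eexists.
- move=> _ _ _ _ [a _ <-] [b _ <-] [a' _ <-] [b' _ <-] /hI.
  by rewrite !hK => /(pcan_inj pickleK)[-> ->].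
Qed.

(** Let [(D, g)] be a maximal pairing. If the complement of [D] were at least as
    large as [D], it would contain a copy of [D] and the pairing would extend by
    [self_pairing_double]. So the complement injects into [D], therefore [T]
    itself does, and [g] gives [T * T <= D * D <= D]. *)
Lemma infinite_card_square T : infinite_set [set: T] ->
  [set: T * T] #<= [set: T].
Proof.
move=> /infinite_self_pairing[s0 s0P].
pose S := {s : set T * (T -> T -> T) | self_pairing s.1 s.2}.
pose ext (s t : set T * (T -> T -> T)) := s.1 `<=` t.1 /\
  forall a b, s.1 a -> s.1 b -> t.2 a b = s.2 a b.
pose R (s t : S) := `[< ext (sval s) (sval t) >].
have [||C Ctot|[[D g] /= Dg] maxD] := @ZL_preorder S (exist _ s0 s0P) R.
- by move=> s; apply/asboolP; split.
- move=> r s t /asboolP[rs rsE] /asboolP[st stE]; apply/asboolP.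
  by split=> [x /rs/st//|a b ra rb]; rewrite stE ?rsE//; exact: rs.
- case: (pselect (exists s, C s)) => [[s1 Cs1]|noC]; last first.
    by exists (exist _ s0 s0P) => s Cs; case: noC; exists s.
  have [|||g [gP gE]] := @self_pairing_bigcup T (sval @` C) (sval s1).
  + by exists s1.
  + by move=> _ [s _ <-]; exact: (svalP s).
  + move=> _ _ [s Cs <-] [t Ct <-].
    by case: (Ctot _ _ Cs Ct) => /asboolP; [left|right].
  exists (exist (fun s => self_pairing s.1 s.2) (_, g) gP) => s Cs.
  apply/asboolP; split=> [x sx|a b sa sb] /=; last by apply: gE => //; exists s.
  by exists (sval s) => //; exists s.
have [[c [d [Dc Dd cd]]] gD ginj] := Dg.
have [] := @card_le_total (~` D) D;
    rewrite (card_le_eql (card_setT _)) (card_le_eqr (card_setT _)).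
  move=> /(self_pairing_absorb Dg); rewrite setUv => -[phi [phiD phiI]].
  apply: (@fun_card_le _ _ _ _ (fun ab => g (phi ab.1) (phi ab.2))) => //.
  have {}phiD x : D (phi x) by exact: phiD.
  move=> [a b] [a' b'] _ _ /=.
  case/(ginj _ _ _ _ (phiD a) (phiD b) (phiD a') (phiD b')).
  by move=> /(phiI _ _ I I) -> /(phiI _ _ I I) ->.
(* [card_le_fun] needs a point in the target; without one, [D] is everything. *)
case: (pselect (exists z, ~ D z)) =>
  [[z Dz] /(card_le_fun (Dz : (~` D) z))[e [eD eI]]|full _].
  have [g' [D'g' g'E]] := self_pairing_double Dg eD eI.
  have := maxD (exist (fun s => self_pairing s.1 s.2) (_, g') D'g').
  case/(_ _)/asboolP => [|/(_ (e c)) De _].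
    by apply/asboolP; split=> // x; left.
  by case: (eD _ Dc); apply: De; right; exists c.
have allD x : D x by apply: contrapT => Dx; apply: full; exists x.
apply: (@fun_card_le _ _ _ _ (fun ab => g ab.1 ab.2)) => //.
by move=> [a b] [a' b'] _ _ /= /ginj[] // -> ->.
Qed.

Lemma card_lt_prod T U V (B : set V) : infinite_set [set: T] ->
  [set: T] #< B -> [set: U] #< B -> [set: U * T] #< B.
Proof.
move=> Tinf TB UB.
suff [W [[WB nBW] UTW]] : exists W, [set: W] #< B /\ [set: U * T] #<= [set: W].
  split; first exact: card_le_trans UTW WB.
  by move=> BUT; apply: nBW; exact: card_le_trans BUT UTW.
have [t _] := infinite_setN0 Tinf.
have [UT|TU] := card_le_total U T.
  exists T; split=> //; apply: card_le_trans (infinite_card_square Tinf).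
  have [f [_ fI]] := card_le_fun (I : [set: T] t) UT.
  apply: (@fun_card_le _ _ _ _ (fun ut => (f ut.1, ut.2))) => // -[u s] [v r] _ _ /=.
  by move=> [/fI-> // ->].
have Uinf : infinite_set [set: U].
  by apply/infiniteP; apply: card_le_trans TU; apply/infiniteP.
have [u _] := infinite_setN0 Uinf.
exists U; split=> //; apply: card_le_trans (infinite_card_square Uinf).
have [f [_ fI]] := card_le_fun (I : [set: U] u) TU.
apply: (@fun_card_le _ _ _ _ (fun ut => (ut.1, f ut.2))) => // -[v s] [w r] _ _ /=.
by move=> [-> /fI->].
Qed.

(** * Unsplit sets *)

Lemma card_bigcup_le V J T (F : J -> set V) :
  (forall i, F i #<= [set: T]) -> \bigcup_i F i #<= [set: J * T].
Proof.
move=> FT.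
have [[S0 [i0 _ FS0]]|no] := pselect (exists S, (\bigcup_i F i) S); last first.
  suff -> : \bigcup_i F i = set0 by exact: card_ge0.
  by apply/eqP/negPn/negP => /set0P.
have [t _] : [set: T] !=set0.
  apply/set0P; apply/eqP => T0; have := FT i0; rewrite T0.
  by move/card_le0P => FiE; move: FS0; rewrite FiE.
have /choice[f fP] (i : J) := card_le_fun (I : [set: T] t) (FT i).
have /choice[k kP] S : exists i, (\bigcup_i F i) S -> F i S.
  case: (pselect ((\bigcup_i F i) S)) => [[i _ FiS]|]; first by exists i.
  by exists i0.
apply: (@fun_card_le _ _ _ _ (fun S => (k S, f (k S) S))) => // S S' FS FS' [kk].
by rewrite kk => /(proj2 (fP _)); apply; [rewrite -kk|]; exact: kP.
Qed.

(** Members of a splitting family are infinite, so the splitting number is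
    compared with the infinite members of [S] only; a finite set splits
    nothing. *)
Lemma unsplit_ex (S : set (set nat)) : ~ (splitting_number #<= S) ->
  exists2 H, infinite_set H &
    forall B, S B -> finite_set (H `&` B) \/ finite_set (H `\` B).
Proof.
move=> sS; apply: contrapT => noH; apply: sS.
have [_ smin] := splitting_numberP.
apply: card_le_trans (smin (S `&` [set A | infinite_set A]) _) _;
  last exact: subset_card_le.
split=> [A []//|A Ainf]; apply: contrapT => noB; apply: noH.
exists A => // B SB; apply: contrapT => /not_orP[AB ADB]; apply: noB.
by exists B => //; split=> //; apply: sub_infinite_set AB.
Qed.

(** * Convergence along unsplit sets *)

Lemma finite_nat_bounded (A : set nat) :
  finite_set A <-> exists N, forall n, A n -> n < N.
Proof.
split=> [/finite_seqP[s ->]|[N AN]]; last exact: sub_finite_set AN (finite_II N).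
by exists (\max_(n <- s) n).+1 => n /= ns; rewrite ltnS leq_bigmax_seq.
Qed.

Lemma infinite_nat_unbounded (A : set nat) N :
  infinite_set A -> exists n, A n /\ N <= n.
Proof.
move=> Ainf; apply: contrapT => noN; apply/Ainf/finite_nat_bounded.
by exists N => n An; rewrite ltnNge; apply/negP => Nn; apply: noN; exists n.
Qed.

(** The subsequence is given by an [e] that tends to infinity without being
    increasing or even injective: this is all that limits see, and it spares
    enumerating [H]. *)
Lemma seq_compact_along (X : topologicalType) (x : nat -> X) (H : set nat) :
  sequentially_compact X -> infinite_set H ->
  exists (p : X) (e : nat -> nat),
    (forall n, H (e n) /\ n <= e n) /\ x (e n) @[n --> \oo] --> p.
Proof.
move=> Xsc Hinf.
have /choice[e eP] n := infinite_nat_unbounded n Hinf.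
have [K Kinf [p xp]] := Xsc (x \o e).
have /choice[k kP] n := infinite_nat_unbounded n Kinf.
exists p, (e \o k); split=> [n|A /xp [N _ NA]].
  by split; [exact: (eP _).1|exact: leq_trans (kP n).2 (eP _).2].
exists N => // n /= Nn; apply: NA; last exact: (kP n).1.
exact: leq_trans Nn (kP n).2.
Qed.

Lemma seq_limits_SeqCl (X : topologicalType) (U : set X) :
  seq_limits U `<=` SeqCl U.
Proof.
move=> q [u uU uq] Z [Zcl UZ]; apply: Zcl; exists u => // n; exact: UZ.
Qed.

(** The candidate limit [p] is that of any convergent subsequence inside [H]. If
    a neighbourhood [A] of [p] misses infinitely many terms along [H], these
    have a subsequence with a limit [q <> p], which the cover separates
    from [p]. *)
Lemma unsplit_converges (X : topologicalType) (x : nat -> X) (H : set nat) C :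
  sequentially_compact X -> seq_sep_limit_cover (range x) C ->
  infinite_set H ->
  (forall U, C U -> finite_set (H `&` x @^-1` U) \/ finite_set (H `\` x @^-1` U)) ->
  converges_along x H.
Proof.
move=> Xsc [Copen Csep] Hinf Hns.
have [p [e [eP xp]]] := seq_compact_along x Xsc Hinf.
exists p => A Ap; apply: contrapT => HA.
pose K := [set n | H n /\ ~ A (x n)].
have Kinf : infinite_set K.
  apply: contra_not HA => Kfin.
  have [N NK] := (finite_nat_bounded K).1 Kfin.
  exists N => // n /= Nn Hn; apply: contrapT => An.
  by have := NK n (conj Hn An); rewrite ltnNge Nn.
have [q [k [kP xq]]] := seq_compact_along x Xsc Kinf.
have qp : q <> p.
  move=> qp; have [N _ NA] : \forall n \near \oo, A (x (k n)).
    by apply: xq; rewrite qp.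
  exact: (kP N).1.2 (NA N (leqnn N)).
have Lp : seq_limits (range x) p by exists (x \o e) => // n; exists (e n).
(* [q] is shown to be in [SeqCl U] after all. *)
have [U CU [Up Uq]] := Csep _ _ Lp qp.
apply: Uq; apply: seq_limits_SeqCl.
have xU n : seq_limits (range x) (x n).
  by exists (fun=> x n) => [_|]; [exists n|exact: cvg_cst].
have [V Vo UE] := Copen _ CU.
have [N _ NV] : \forall n \near \oo, V (x (e n)).
  by apply: xp; apply: open_nbhs_nbhs; split=> //; move: Up; rewrite UE => -[].
(* Infinitely many [e n] are in [H] with [x (e n)] in [U], so the first case is
   impossible; in the second, [U] holds along [H] from [M] on. *)
have [/finite_nat_bounded[M HM]|/finite_nat_bounded[M HM]] := Hns _ CU.
  have [He le_e] := eP (maxn N M).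
  have : e (maxn N M) < M.
    apply: HM; split=> //=; rewrite UE; split; first exact: xU.
    exact: (NV _ (leq_maxl N M)).
  by rewrite ltnNge (leq_trans (leq_maxr N M) le_e).
exists (fun n => x (k (n + M))) => [n|B /xq[N' _ NB]].
  have [[Hk _] le_k] := kP (n + M); apply: contrapT => nU.
  have : k (n + M) < M by apply: HM.
  by rewrite ltnNge (leq_trans (leq_addl n M) le_k).
exists N' => // n /= N'n; apply: NB => /=; exact: leq_trans N'n (leq_addr M n).
Qed.

Theorem lemma4p14 (kappa : Type) (Hkappa : [set: kappa] #< splitting_number)
    (lambda : Type) (Hlambda : [set: lambda] #< splitting_number) :
  ssc lambda (fun X : topologicalType =>
    sequentially_compact X /\
    exists hX : hausdorff_space X, cHw hX #<= [set: kappa]).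
Proof.
move=> X x XF.
have [[i0 _]|no_i] := pselect (exists i : lambda, True); last first.
  by exists setT => [|i]; [exact: infinite_nat|case: no_i; exists i].
have XC i : cHw_bound (X i) kappa.
  have [_ [hX le_k]] := XF i; apply: cHw_bound_le (cHwP hX).1.
  by rewrite (card_le_eql (card_setT _)).
(* The spaces depend on [i], their traces do not: [F i] consists of subsets of
   [nat], so the union over [i] makes sense. *)
have /choice[F FP] i : exists F : set (set nat), F #<= [set: kappa] /\
    forall H, infinite_set H ->
      (forall B, F B -> finite_set (H `&` B) \/ finite_set (H `\` B)) ->
      converges_along (x i) H.
  have [_ /(_ (range (x i)))[|C CY Ck]] := XC i.
    by apply: card_le_trans (card_image_le _ _) _; exact: countableP.
  exists ((fun U => x i @^-1` U) @` C); split.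
    exact: card_le_trans (card_image_le _ _) Ck.
  move=> H Hinf HF; apply: unsplit_converges CY Hinf _; first exact: (XF i).1.
  by move=> U CU; apply: HF; exists U.
have [|H Hinf HF] := @unsplit_ex (\bigcup_i F i).
  move=> sF; have [_] := card_lt_prod (XC i0).1 Hkappa Hlambda; apply.
  by apply: card_le_trans sF _; apply: card_bigcup_le => i; exact: (FP i).1.
exists H => // i; apply: (FP i).2 => // B FB; apply: HF; by exists i.
Qed.
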